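(* Let $\mathbf E$ and $\mathbf E'$ be two pointed geodesic compact metric spaces. Then $$d_{\mathrm{GH}}\big(\mathrm{Kac}(\mathbf E),\mathrm{Kac}(\mathbf E')\big)\le 6\,d_{\mathrm{GH}}(\mathbf E,\mathbf E').$$
   Context: **Geodesic spaces.** A metric space $(E,d)$ is geodesic if for every $a,b\in E$ there is a curve $\gamma:[0,d(a,b)]\to E$ with $\gamma(0)=a$, $\gamma(d(a,b))=b$ and $d(\gamma(s),\gamma(t))=t-s$ for $0\leq s\le t\leq d(a,b)$. **Continuous cactus.** For a pointed geodesic compact metric space $\mathbf E=(E,d,\rho)$ and $a,b\in E$ put $$d^{\mathbf E}_{\mathrm{Kac}}(a,b)=d(\rho,a)+d(\rho,b)-2\sup_{\gamma:a\to b}\min_{0\le t\le1}d(\rho,\gamma(t)),$$ the supremum being over continuous curves $\gamma:[0,1]\to E$ with $\gamma(0)=a,\gamma(1)=b$. This is a pseudo-distance; $\mathrm{Kac}(\mathbf E)$ is the quotient of $E$ by $\{d^{\mathbf E}_{\mathrm{Kac}}=0\}$ with the induced distance (a compact metric space), pointed at the class of $\rho$. **Gromov-Hausdorff distance.** For pointed compact metric spaces $\mathbf E=(E,d,\rho)$, $\mathbf E'=(E',d',\rho')$, $$d_{\mathrm{GH}}(\mathbf E,\mathbf E')=\inf\{d_{\mathrm H}^F(\phi(E),\phi'(E'))\vee\delta(\phi(\rho),\phi'(\rho'))\},$$ where the infimum is over all metric spaces $(F,\delta)$ and isometric embeddings $\phi:E\to F$, $\phi':E'\to F$, and $d_{\mathrm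 H}^F$ is the Hausdorff distance in $F$. *)

(* Defs.v *)
From HB Require Import structures.
From mathcomp Require Import all_boot all_order generic_quotient all_algebra.
From mathcomp Require Import lra.
From mathcomp Require Import all_classical all_reals all_analysis.

Set Implicit Arguments.
Unset Strict Implicit.
Unset Printing Implicit Defensive.

Import Order.TTheory GRing.Theory Num.Theory.
Import numFieldNormedType.Exports.

Local Open Scope classical_set_scope.
Local Open Scope ring_scope.
Local Open Scope quotient_scope.

(* Curves are total functions on R; only their values on the relevant interval
   matter. *)
Definition geodesic (R : realType) (E : metricType R) :=
  forall a b : E, exists gamma : R -> E,
    [/\ gamma 0 = a, gamma (mdist a b) = b &
        forall s t, 0 <= s -> s <= t -> t <= mdist a b ->
          mdist (gamma s) (gamma t) = t - s].

Definition curves (R : realType) (E : metricType R) (a b : E) : set (R -> E) :=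
  [set gamma | [/\ {within `[0, 1 : R], continuous gamma},
                   gamma 0 = a & gamma 1 = b]].

Section Cactus.
Context {R : realType} {E : metricType R} (rho : E).

(* [t |-> mdist rho (gamma t)] is continuous on [0, 1] when [gamma] is a curve,
   so that this infimum is a minimum. *)
Definition curve_min (gamma : R -> E) : R :=
  inf [set mdist rho (gamma t) | t in `[0, 1]].

(* When [a] and [b] are joined by a curve, as is always the case in a geodesic
   space, this is the supremum of a nonempty set bounded by [mdist rho a].
   Otherwise [sup set0 = 0], and [dKac] is still a pseudo-distance. *)
Definition kac_height (a b : E) : R :=
  sup [set curve_min gamma | gamma in curves a b].

Definition dKac (a b : E) : R :=
  mdist rho a + mdist rho b - 2 * kac_height a b.

Lemma curve_min_le (gamma : R -> E) (t : R) :
  0 <= t <= 1 -> curve_min gamma <= mdist rho (gamma t).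
Proof.
move=> t01; apply: ge_inf; last by exists t => //=; rewrite in_itv.
by exists 0 => _ [s _ <-]; exact: mdist_ge0.
Qed.

Lemma le_curve_min (gamma : R -> E) (x : R) :
  (forall t, 0 <= t <= 1 -> x <= mdist rho (gamma t)) -> x <= curve_min gamma.
Proof.
move=> xg; apply: lb_le_inf.
  by exists (mdist rho (gamma 0)), 0 => //=; rewrite in_itv/= lexx ler01.
by move=> _ [t /= t01 <-]; move: t01; rewrite in_itv => /xg.
Qed.

Lemma curve_min_le_kac_height (a b : E) (gamma : R -> E) :
  curves a b gamma -> curve_min gamma <= kac_height a b.
Proof.
move=> cg; apply: ub_le_sup; last by exists gamma.
exists (mdist rho a) => _ [g [_ <- _] <-].
by apply: curve_min_le; rewrite lexx ler01.
Qed.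

Lemma kac_height_ge0 (a b : E) : 0 <= kac_height a b.
Proof.
rewrite /kac_height; have [->|/set0P[g cg]] := eqVneq (curves a b) set0.
  by rewrite image_set0 sup0.
apply: le_trans (curve_min_le_kac_height cg).
by apply: le_curve_min => t _; exact: mdist_ge0.
Qed.

Lemma kac_height_le (a b : E) (x : R) : 0 <= x ->
  (forall gamma, curves a b gamma -> curve_min gamma <= x) ->
  kac_height a b <= x.
Proof.
move=> x0 xg; rewrite /kac_height.
have [->|/set0P[g cg]] := eqVneq (curves a b) set0.
  by rewrite image_set0 sup0.
by apply: ge_sup; [exists (curve_min g), g|move=> _ [h ch <-]; exact: xg].
Qed.

Lemma kac_height_lel (a b : E) : kac_height a b <= mdist rho a.
Proof.
apply: kac_height_le => [|g [_ <- _]]; first exact: mdist_ge0.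
by apply: curve_min_le; rewrite lexx ler01.
Qed.

Lemma kac_height_ler (a b : E) : kac_height a b <= mdist rho b.
Proof.
apply: kac_height_le => [|g [_ _ <-]]; first exact: mdist_ge0.
by apply: curve_min_le; rewrite lexx ler01.
Qed.

Lemma curves_cst (a : E) : curves a a (cst a).
Proof. by split=> //; apply: continuous_subspaceT => x; exact: cvg_cst. Qed.

Lemma within_comp_affine (A B : set R) (f : R -> R) (gamma : R -> E) :
  continuous f -> (forall t, A t -> B (f t)) ->
  {within B, continuous gamma} -> {within A, continuous (gamma \o f)}.
Proof.
move=> cf fAB /subspace_continuousP cg; apply/subspace_continuousP => t At.
apply: cvg_trans (cg _ (fAB _ At)) => P nP.
have ntP : nbhs (f t) [set s | B s -> P (gamma s)] by exact: nP.
have nP' : nbhs t [set s | B (f s) -> P (gamma (f s))] by exact: cf ntP.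
suff: nbhs t [set s | A s -> P (gamma (f s))] by [].
by apply: filterS nP' => s + As; apply; exact: fAB.
Qed.

Lemma curves_rev (a b : E) (gamma : R -> E) :
  curves a b gamma -> curves b a (fun t => gamma (1 - t)).
Proof.
move=> [cg g0 g1]; split; [|by rewrite subr0|by rewrite subrr].
apply: (@within_comp_affine _ `[0, 1] (fun t => 1 - t) gamma _ _ cg) => [t|t].
  by apply: cvgB; [exact: cvg_cst|exact: cvg_id].
by rewrite /= !in_itv/=; lra.
Qed.

Definition curve_cat (g h : R -> E) (t : R) : E :=
  if t <= 2^-1 then g (2 * t) else h (2 * t - 1).

Lemma curves_cat (a b c : E) (g h : R -> E) :
  curves a c g -> curves c b h -> curves a b (curve_cat g h).
Proof.
move=> [cg g0 g1] [ch h0 h1]; split; last 2 first.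
- by rewrite /curve_cat mulr0 invr_ge0 ler0n.
- rewrite /curve_cat ifF; first by rewrite mulr1 -[2]/(1 + 1) addrK.
  by apply/negbTE; rewrite -ltNge; lra.
have -> : [set` `[0, 1 : R]] = [set` `[0, 2^-1]] `|` [set` `[2^-1, 1]].
  by apply/seteqP; split=> t /=; rewrite !in_itv/=; [|case]; lra.
apply: withinU_continuous; [exact: itv_closed..| |].
- have : {within [set` `[0, 2^-1 : R]], continuous (g \o *%R 2)}.
    apply: (within_comp_affine _ _ cg) => [t|t]; last by rewrite /= !in_itv/=; lra.
    by apply: cvgMr; exact: cvg_id.
  apply: subspace_eq_continuous => t; rewrite inE/= in_itv/= => /andP[_ t2].
  by rewrite /from_subspace /curve_cat t2.
- have : {within [set` `[2^-1, 1 : R]],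
      continuous (h \o (fun t => 2 * t - 1))}.
    apply: (within_comp_affine _ _ ch) => [t|t]; last by rewrite /= !in_itv/=; lra.
    by apply: cvgB; [apply: cvgMr; exact: cvg_id|exact: cvg_cst].
  apply: subspace_eq_continuous => t; rewrite inE/= in_itv/= => /andP[t2 _].
  rewrite /from_subspace /curve_cat; case: ifPn => //= t2'.
  have -> : t = 2^-1 by apply/eqP; rewrite eq_le t2' t2.
  by rewrite mulfV ?pnatr_eq0// subrr g1 h0.
Qed.

Lemma dKacxx (a : E) : dKac a a = 0.
Proof.
apply/eqP; rewrite /dKac subr_eq0 eq_le; apply/andP; split; last first.
  by have := kac_height_lel a a; lra.
suff: mdist rho a <= kac_height a a by lra.
by apply: le_trans (curve_min_le_kac_height (curves_cst a)); exact: le_curve_min.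
Qed.

Lemma dKac_sym (a b : E) : dKac a b = dKac b a.
Proof.
suff le_height x y : kac_height x y <= kac_height y x.
  rewrite /dKac (addrC (mdist rho a)); congr (_ - 2 * _).
  by apply/eqP; rewrite eq_le !le_height.
apply: kac_height_le => [|g cg]; first exact: kac_height_ge0.
apply: le_trans (curve_min_le_kac_height (curves_rev cg)).
by apply: le_curve_min => t t01; apply: curve_min_le; lra.
Qed.

Lemma dKac_triangle (c a b : E) : dKac a b <= dKac a c + dKac c b.
Proof.
suff: kac_height a c + kac_height c b <= kac_height a b + mdist rho c.
  by rewrite /dKac; lra.
have hab := kac_height_ge0 a b.
have hac := kac_height_ler a c; have hcb := kac_height_lel c b.
rewrite -lerBrDr; apply: kac_height_le => [|g cg]; first by lra.
rewrite lerBrDr addrC -lerBrDr; apply: kac_height_le => [|h ch].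
  have [_ _ gc] := cg; have := @curve_min_le g 1.
  by rewrite gc lexx ler01 => /(_ isT); lra.
have gc : curve_min g <= mdist rho c.
  by have [_ _ <-] := cg; apply: curve_min_le; rewrite lexx ler01.
have hc : curve_min h <= mdist rho c.
  by have [_ <- _] := ch; apply: curve_min_le; rewrite lexx ler01.
have := curve_min_le_kac_height (curves_cat cg ch).
suff : Num.min (curve_min g) (curve_min h) <= curve_min (curve_cat g h).
  by rewrite /Num.min; case: ifP => _; lra.
apply: le_curve_min => t t01; rewrite /curve_cat ge_min.
case: ifPn => [t2|]; first by rewrite curve_min_le//; lra.
by rewrite -ltNge => t2; rewrite orbC curve_min_le//; lra.
Qed.

Lemma dKac_ge0 (a b : E) : 0 <= dKac a b.
Proof. by have := dKac_triangle b a a; rewrite dKacxx (dKac_sym b a); lra. Qed.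

Definition kac_rel : rel E := fun a b => dKac a b == 0.

Lemma kac_rel_refl : reflexive kac_rel.
Proof. by move=> a; rewrite /kac_rel dKacxx. Qed.

Lemma kac_rel_sym : symmetric kac_rel.
Proof. by move=> a b; rewrite /kac_rel dKac_sym. Qed.

Lemma kac_rel_trans : transitive kac_rel.
Proof.
move=> b a c /eqP ab /eqP bc; rewrite /kac_rel eq_le dKac_ge0 andbT.
by have := dKac_triangle b a c; rewrite ab bc addr0.
Qed.

Canonical kac_equiv := EquivRel kac_rel kac_rel_refl kac_rel_sym kac_rel_trans.

Definition Kac := {eq_quot kac_equiv}.

HB.instance Definition _ := Choice.on Kac.
HB.instance Definition _ := Quotient.on Kac.

Definition Kac_dist (x y : Kac) : R := dKac (repr x) (repr y).

Lemma Kac_dist_pi (a b : E) : Kac_dist (\pi_Kac a) (\pi_Kac b) = dKac a b.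
Proof.
have rK x : dKac (repr (\pi_Kac x)) x = 0.
  by apply/eqP/(@eqmodP _ kac_equiv); rewrite reprK.
rewrite /Kac_dist; apply/eqP; rewrite eq_le; apply/andP; split.
  have := dKac_triangle a (repr (\pi_Kac a)) (repr (\pi_Kac b)).
  have := dKac_triangle b a (repr (\pi_Kac b)).
  by rewrite (dKac_sym b) !rK; lra.
have := dKac_triangle (repr (\pi_Kac a)) a b.
have := dKac_triangle (repr (\pi_Kac b)) (repr (\pi_Kac a)) b.
by rewrite (dKac_sym a (repr _)) !rK; lra.
Qed.

Lemma Kac_distxx (x : Kac) : Kac_dist x x = 0.
Proof. exact: dKacxx. Qed.

Lemma Kac_dist_eq0 (x y : Kac) : Kac_dist x y = 0 -> x = y.
Proof. by move=> /eqP/(@eqmodP _ kac_equiv); rewrite !reprK. Qed.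

Lemma Kac_dist_sym (x y : Kac) : Kac_dist x y = Kac_dist y x.
Proof. exact: dKac_sym. Qed.

Lemma Kac_dist_triangle (y x z : Kac) :
  Kac_dist x z <= Kac_dist x y + Kac_dist y z.
Proof. exact: dKac_triangle. Qed.

HB.instance Definition _ := @isMetric.Build R Kac Kac_dist
  Kac_distxx Kac_dist_eq0 Kac_dist_sym Kac_dist_triangle.

Definition Kac_root : Kac := \pi_Kac rho.

Lemma mdist_Kac (a b : E) :
  mdist (\pi_Kac a : Kac) (\pi_Kac b : Kac) = dKac a b.
Proof. exact: Kac_dist_pi. Qed.

End Cactus.

Local Open Scope ereal_scope.

Definition dist_to_set (R : realType) (F : metricType R) (x : F) (B : set F) :
    \bar R :=
  ereal_inf [set (mdist x b)%:E | b in B].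

(* Extended-real valued, since it may be infinite without compactness. *)
Definition hausdorff_dist (R : realType) (F : metricType R) (A B : set F) :
    \bar R :=
  maxe (ereal_sup [set dist_to_set a B | a in A])
       (ereal_sup [set dist_to_set b A | b in B]).

Definition isometric_embedding (R : realType) (E F : metricType R)
    (phi : E -> F) :=
  forall x y, mdist (phi x) (phi y) = mdist x y.

(* The distance of the pointed spaces (E, rho) and (E', rho'), a real number
   when both are compact. *)
Definition dGH (R : realType) (E E' : metricType R) (rho : E) (rho' : E') :
    \bar R :=
  ereal_inf [set r | exists (F : metricType R) (phi : E -> F) (phi' : E' -> F),
    [/\ isometric_embedding phi, isometric_embedding phi' &
        r = maxe (hausdorff_dist (range phi) (range phi'))
                 (mdist (phi rho) (phi' rho'))%:E]].

(* Main.v *)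
Require Import Defs.
From mathcomp Require Import all_boot all_order all_algebra.
From mathcomp Require Import all_classical all_reals all_analysis.
From HB Require Import structures.
From mathcomp Require Import lra generic_quotient.

Set Implicit Arguments.
Unset Strict Implicit.
Unset Printing Implicit Defensive.

Import Order.TTheory GRing.Theory Num.Theory.
Import numFieldNormedType.Exports.

Local Open Scope classical_set_scope.
Local Open Scope ring_scope.
Local Open Scope quotient_scope.

(** Fix common isometric embeddings of E and E' and e > d_GH(E, E'), and call
    points a, a' of E, E' matched when their images are at distance at most e.
    Follow a curve in E from a to b in steps of length at most e, match each
    intermediate point, and join consecutive matched points by geodesics of E',
    of length at most 3 e. Matching changes distances to the root by at most
    2 e, and a point of such a geodesic is within 3 e / 2 of an endpoint, so
    the resulting curve loses at most 4 e of height. Hence matching is a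
    correspondence between the cactuses of distortion at most
    2 * 2 e + 2 * 4 e = 12 e, and gluing the cactuses along it at distance 6 e
    gives the constant 6. *)

(** The local hypothesis is symmetric in [s] and [u], so membership in [S] is locally constant on
    the segment. The trace of [S] is thus open and closed there, and connectedness concludes. *)
Lemma segment_local_propagation (R : realType) (S : set R) :
  S 0 ->
  (forall t : R, `[0, 1]%classic t -> exists2 N, nbhs t N &
     forall s u, `[0, 1]%classic s -> `[0, 1]%classic u ->
       N s -> N u -> S s -> S u) ->
  S 1.
Proof.
move=> S0 hS; pose I : set R := `[0, 1]%classic.
have I0 : I 0 by rewrite /I /= in_itv/= lexx ler01.
have I1 : I 1 by rewrite /I /= in_itv/= lexx ler01.
suff IS : I `&` S = I by move: I1; rewrite -IS => -[].
have cI : connected I by apply/connected_intervalP; exact: interval_is_interval.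
apply: cI; first by exists 0.
- exists (interior [set s | I s -> S s]); first exact: open_interior.
  apply/seteqP; split=> t [It].
    move=> St; split=> //; have [N Nt hN] := hS t It.
    rewrite /interior/=; apply: filterS (Nt) => s Ns Is.
    exact: hN (nbhs_singleton Nt) Ns St.
  by move=> /nbhs_singleton/= /(_ It).
- exists (~` interior [set s | I s -> ~ S s]).
    exact/open_closedC/open_interior.
  apply/seteqP; split=> t [It].
    by move=> St; split=> // /nbhs_singleton/= /(_ It).
  move=> nS; split=> //; apply: contrapT => nSt; apply: nS.
  have [N Nt hN] := hS t It.
  rewrite /interior/=; apply: filterS (Nt) => s Ns Is Ss; apply: nSt.
  exact: hN Ns (nbhs_singleton Nt) Ss.
Qed.

(** * Curves staying far from the root *)

Section JoinedAbove.
Context {R : realType} {E : metricType R} (rho : E).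

Definition joined_above (m : R) (a b : E) :=
  exists2 gamma : R -> E, curves a b gamma & m <= curve_min rho gamma.

Lemma joined_above_trans (m : R) (b a c : E) :
  joined_above m a b -> joined_above m b c -> joined_above m a c.
Proof.
move=> [g cg mg] [h ch mh]; exists (curve_cat g h); first exact: curves_cat cg ch.
apply: le_curve_min => t t01; rewrite /curve_cat; case: ifPn => [t2|].
  by apply: le_trans mg _; apply: curve_min_le; lra.
by rewrite -ltNge => t2; apply: le_trans mh _; apply: curve_min_le; lra.
Qed.

(** Every point of a geodesic lies within half its length of one endpoint, so the triangle
    inequality loses at most [mdist a b / 2]. *)
Lemma geodesic_joined_above (m : R) (a b : E) : geodesic E ->
  m + mdist a b / 2 <= mdist rho a -> m + mdist a b / 2 <= mdist rho b ->
  joined_above m a b.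
Proof.
move=> /(_ a b)[g [g0 g1 gd]] ma mb; set D := mdist a b in g1 gd ma mb.
have D0 : 0 <= D by exact: mdist_ge0.
have gdist s t : 0 <= s <= 1 -> 0 <= t <= 1 ->
    mdist (g (s * D)) (g (t * D)) = `|s - t| * D.
  wlog st : s t / s <= t => [hw s01 t01|/andP[s0 s1] /andP[t0 t1]].
    have [st|/ltW ts] := leP s t; first exact: hw.
    by rewrite metric_sym hw// distrC.
  rewrite gd ?mulr_ge0 ?ler_wpM2r//; last by rewrite ler_piMl.
  by rewrite distrC ger0_norm ?subr_ge0// mulrBl.
exists (fun t => g (t * D)).
  split; [|by rewrite mul0r|by rewrite mul1r].
  apply/subspace_continuousP => t /=; rewrite in_itv/= => t01 P.
  rewrite -nbhs_ballE => -[e /= e0 eP].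
  suff: nbhs t [set s | `[0, 1]%classic s -> P (g (s * D))] by [].
  (* [D] vanishes when [a = b]; dividing by [D + 1] avoids a case distinction. *)
  have D1 : 0 < D + 1 by rewrite ltr_wpDl.
  have := nbhsx_ballx t _ (divr_gt0 e0 D1).
  apply: filterS => s /=; rewrite in_itv/= -ball_normE/= => ts s01.
  apply: eP; rewrite ballEmdist/= gdist//.
  rewrite ltr_pdivlMr// in ts; apply: le_lt_trans ts.
  by rewrite ler_wpM2l// lerDl ler01.
apply: le_curve_min => t t01; have [t2|t2] := leP t 2^-1.
  have := metric_triangle rho (g (t * D)) a.
  have := gdist t 0 t01; rewrite mul0r g0 subr0 => ->; last by lra.
  rewrite ger0_norm; last by lra.
  by have : t * D <= 2^-1 * D by [rewrite ler_wpM2r]; lra.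
have := metric_triangle rho (g (t * D)) b.
have := gdist t 1 t01; rewrite mul1r g1 => ->; last by lra.
rewrite distrC ger0_norm; last by lra.
have : (1 - t) * D <= 2^-1 * D by rewrite ler_wpM2r//; lra.
lra.
Qed.

End JoinedAbove.

(** * Comparison of heights in nearby spaces *)

Lemma kac_height_le_approx (R : realType) (E E' F : metricType R)
    (phi : E -> F) (phi' : E' -> F) (rho : E) (rho' : E') (e : R)
    (a b : E) (a' b' : E') :
  0 < e -> isometric_embedding phi -> isometric_embedding phi' ->
  geodesic E' -> (forall x, exists x', mdist (phi x) (phi' x') <= e) ->
  mdist (phi rho) (phi' rho') <= e ->
  mdist (phi a) (phi' a') <= e -> mdist (phi b) (phi' b') <= e ->
  kac_height rho a b <= kac_height rho' a' b' + 4 * e.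
Proof.
move=> e0 iphi iphi' geoE' tot rr aa bb.
have h0 := kac_height_ge0 rho' a' b'.
apply: kac_height_le => [|g cg]; first by lra.
(* Matching costs [2 * e] and half a geodesic [3 * e / 2]; the sum is rounded up to [4 * e]. *)
set m := curve_min rho g - 4 * e.
suff: joined_above rho' m a' b'.
  move=> [h ch mh]; have := curve_min_le_kac_height rho' ch.
  by rewrite /m in mh; lra.
have far x' t : 0 <= t <= 1 -> mdist (phi (g t)) (phi' x') <= e ->
    curve_min rho g - 2 * e <= mdist rho' x'.
  move=> /(curve_min_le rho g); rewrite -(iphi rho) -(iphi' rho') => gt tx.
  have := metric_triangle (phi rho) (phi' rho') (phi (g t)).
  have := metric_triangle (phi' rho') (phi' x') (phi (g t)).
  by rewrite (metric_sym (phi' x')); lra.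
have step s u x' y' : 0 <= s <= 1 -> 0 <= u <= 1 ->
    mdist (phi (g s)) (phi' x') <= e -> mdist (phi (g u)) (phi' y') <= e ->
    mdist (g s) (g u) <= e -> joined_above rho' m x' y'.
  move=> s01 u01 sx uy su.
  have xy : mdist x' y' <= 3 * e.
    rewrite -iphi'; rewrite -iphi in su.
    have := metric_triangle (phi' x') (phi (g s)) (phi' y').
    have := metric_triangle (phi (g s)) (phi (g u)) (phi' y').
    by rewrite (metric_sym (phi' x') (phi (g s))); lra.
  have := far _ _ s01 sx; have := far _ _ u01 uy.
  by move=> ? ?; apply: geodesic_joined_above => //; rewrite /m; lra.
have [gc g0 g1] := cg.
(* Continuity only provides nearby parameters with nearby values: a clopen
   argument on the segment replaces the subdivision of the curve. *)
pose S t := forall x', mdist (phi (g t)) (phi' x') <= e ->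
  joined_above rho' m a' x'.
(* As [S] concerns every match of [g t], not a chosen one, [S 1] applies to the prescribed [b']. *)
suff: S 1 by apply; rewrite g1.
apply: segment_local_propagation => [x' ax|t t01].
  apply: (step 0 0); rewrite ?lexx ?ler01//; first by rewrite g0.
  by rewrite mdistxx ltW.
(* Two values within [e / 2] of [g t] are within [e] of each other, as [step] requires. *)
have e20 : 0 < e / 2 by rewrite divr_gt0.
have := nbhsx_ballx (g t) _ e20.
move/subspace_continuousP : gc => /(_ t t01) gt /gt gN.
exists [set s | `[0, 1]%classic s -> ball (g t) (e / 2) (g s)]; first exact: gN.
move=> s u s01 u01 /(_ s01) ts /(_ u01) tu Ss y' uy.
have [x' sx] := tot (g s).
apply: joined_above_trans (Ss _ sx) _.
move: s01 u01; rewrite /= !in_itv/= => s01 u01.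
apply: (step s u) => //.
move: ts tu; rewrite ballEmdist/= => ts tu.
have := metric_triangle (g s) (g t) (g u).
by rewrite (metric_sym (g s) (g t)); lra.
Qed.

(** * Gluing two metric spaces along a correspondence *)

Section Glue.
Context {R : realType} {A B : metricType R} (C : A -> B -> Prop) (D : R).

(** Each pair related by [C] is a bridge of length [D]; the infimum is over all bridges. *)
Definition cross_dist (x : A) (y : B) : R :=
  inf [set mdist x z.1 + D + mdist z.2 y | z in [set z | C z.1 z.2]].

Definition glue_dist (u v : A + B) : R :=
  match u, v with
  | inl x, inl y => mdist x y
  | inr x, inr y => mdist x y
  | inl x, inr y | inr y, inl x => cross_dist x y
  end.

Context (D0 : 0 < D) (C_nonempty : exists x y, C x y).
Context (C_distortion : forall x x' y y', C x y -> C x' y' ->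
  `|mdist x x' - mdist y y'| <= 2 * D).

Lemma cross_dist_le (x : A) (y : B) (z : A) (w : B) :
  C z w -> cross_dist x y <= mdist x z + D + mdist w y.
Proof.
move=> zw; apply: ge_inf; last by exists (z, w).
by exists 0 => _ [[z' w'] _ <-]; rewrite !addr_ge0 ?mdist_ge0// ltW.
Qed.

Lemma le_cross_dist (x : A) (y : B) (c : R) :
  (forall z w, C z w -> c <= mdist x z + D + mdist w y) -> c <= cross_dist x y.
Proof.
move=> h; apply: lb_le_inf => [|_ [[z w] zw <-]]; last exact: h.
have [z [w zw]] := C_nonempty.
by exists (mdist x z + D + mdist w y), (z, w).
Qed.

(** A positive [D] keeps the two copies apart, so that the glued distance separates points. *)
Lemma cross_dist_gt0 (x : A) (y : B) : 0 < cross_dist x y.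
Proof.
apply: lt_le_trans D0 _; apply: le_cross_dist => z w _.
by have := mdist_ge0 x z; have := mdist_ge0 w y; lra.
Qed.

Lemma glue_distxx u : glue_dist u u = 0.
Proof. by case: u => x /=; rewrite mdistxx. Qed.

Lemma glue_dist_eq0 u v : glue_dist u v = 0 -> u = v.
Proof.
case: u v => x [] y /= xy.
- by rewrite (mdist_positivity _ _ xy).
- by have := cross_dist_gt0 x y; rewrite xy ltxx.
- by have := cross_dist_gt0 y x; rewrite xy ltxx.
- by rewrite (mdist_positivity _ _ xy).
Qed.

Lemma glue_dist_sym u v : glue_dist u v = glue_dist v u.
Proof. by case: u v => x [] y //=; rewrite metric_sym. Qed.

Lemma glue_dist_triangle v u w :
  glue_dist u w <= glue_dist u v + glue_dist v w.
Proof.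
have cross_triangle_l x y z : cross_dist x z <= mdist x y + cross_dist y z.
  rewrite -lerBlDl; apply: le_cross_dist => p q pq; rewrite lerBlDl.
  apply: le_trans (cross_dist_le _ _ pq) _.
  by have := metric_triangle x y p; lra.
have cross_triangle_r x y z : cross_dist x z <= cross_dist x y + mdist y z.
  rewrite -lerBlDr; apply: le_cross_dist => p q pq; rewrite lerBlDr.
  apply: le_trans (cross_dist_le _ _ pq) _.
  by have := metric_triangle q y z; lra.
(* Going over and back uses two bridges, whose total length [2 * D] absorbs the distortion. *)
have cross_sum_l x y z : mdist x y <= cross_dist x z + cross_dist y z.
  rewrite -lerBlDr; apply: le_cross_dist => p q pq; rewrite lerBlDr -lerBlDl.
  apply: le_cross_dist => p' q' pq'; rewrite lerBlDl.
  have := C_distortion pq pq'; rewrite ler_norml => /andP[_].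
  have := metric_triangle x p y; have := metric_triangle p p' y.
  have := metric_triangle q z q'.
  by rewrite (metric_sym z) (metric_sym p' y); lra.
have cross_sum_r x y z : mdist y z <= cross_dist x y + cross_dist x z.
  rewrite -lerBlDr; apply: le_cross_dist => p q pq; rewrite lerBlDr -lerBlDl.
  apply: le_cross_dist => p' q' pq'; rewrite lerBlDl.
  have := C_distortion pq pq'; rewrite ler_norml => /andP[+ _].
  have := metric_triangle y q z; have := metric_triangle q q' z.
  have := metric_triangle p x p'.
  by rewrite (metric_sym p x) (metric_sym y q); lra.
case: u v w => [x|x] [y|y] [z|z] /=; rewrite ?metric_triangle//.
- by rewrite addrC (metric_sym y).
- by rewrite addrC (metric_sym x).
Qed.

End Glue.

Lemma dGH_le_correspondence (R : realType) (A B : metricType R)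
    (C : A -> B -> Prop) (D : R) (a : A) (b : B) :
  0 < D -> C a b -> (forall x, exists y, C x y) -> (forall y, exists x, C x y) ->
  (forall x x' y y', C x y -> C x' y' ->
     `|mdist x x' - mdist y y'| <= 2 * D) ->
  (dGH a b <= D%:E)%E.
Proof.
move=> D0 Cab totl totr dis.
have C0 : exists x y, C x y by exists a, b.
(* The metric axioms depend on [D0], [C0] and [dis], so the structure is built locally. *)
pose M := @isMetric.Build R (A + B)%type (glue_dist C D)
  (glue_distxx C D) (@glue_dist_eq0 _ _ _ C D D0 C0) (glue_dist_sym C D)
  (@glue_dist_triangle _ _ _ C D D0 C0 dis).
pose F : metricType R := HB.pack (A + B)%type M.
have near x y : C x y -> @mdist R F (inl x) (inr y) <= D.
  move=> xy; have := cross_dist_le D0 x y xy.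
  by rewrite !mdistxx add0r addr0.
apply: ge_ereal_inf.
exists (maxe (hausdorff_dist (range (inl : A -> F)) (range (inr : B -> F)))
             (@mdist R F (inl a) (inr b))%:E).
  by exists F, inl, inr; split.
rewrite /hausdorff_dist !ge_max lee_fin near// andbT; apply/andP; split.
  apply: ge_ereal_sup => _ [_ [x _ <-] <-]; have [y xy] := totl x.
  apply: ge_ereal_inf; exists (@mdist R F (inl x) (inr y))%:E.
    by exists (inr y).
  by rewrite lee_fin near.
apply: ge_ereal_sup => _ [_ [y _ <-] <-]; have [x xy] := totr y.
apply: ge_ereal_inf; exists (@mdist R F (inr y) (inl x))%:E.
  by exists (inl x).
by rewrite lee_fin metric_sym near.
Qed.

(** * From an approximate matching to the cactuses *)

(** The distance to a set is an infimum that may not be attained, hence the slack [r < e]. *)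
Lemma hausdorff_dist_le_near (R : realType) (F : metricType R) (A B : set F)
    (r e : R) (x : F) :
  (hausdorff_dist A B <= r%:E)%E -> r < e -> A x ->
  exists2 y, B y & mdist x y <= e.
Proof.
rewrite /hausdorff_dist ge_max => /andP[AB _] re Ax.
have : (dist_to_set x B < e%:E)%E.
  apply: le_lt_trans (_ : (r%:E < e%:E)%E); last by rewrite lte_fin.
  by apply: le_trans AB; apply: ereal_sup_ubound; exists x.
by move=> /ereal_inf_lt[_ [y By <-]]; rewrite lte_fin => /ltW; exists y.
Qed.

Lemma hausdorff_distC (R : realType) (F : metricType R) (A B : set F) :
  hausdorff_dist A B = hausdorff_dist B A.
Proof. by rewrite /hausdorff_dist maxC. Qed.

Lemma dGH_Kac_le (R : realType) (E E' F : metricType R)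
    (phi : E -> F) (phi' : E' -> F) (rho : E) (rho' : E') (e : R) :
  0 < e -> isometric_embedding phi -> isometric_embedding phi' ->
  geodesic E -> geodesic E' ->
  (forall x, exists x', mdist (phi x) (phi' x') <= e) ->
  (forall x', exists x, mdist (phi' x') (phi x) <= e) ->
  mdist (phi rho) (phi' rho') <= e ->
  (dGH (Kac_root rho) (Kac_root rho') <= (6 * e)%:E)%E.
Proof.
move=> e0 iphi iphi' geoE geoE' totl totr rr.
(* Any matched representatives relate two classes; [mdist_Kac] computes distances from any of
   them. *)
pose C (p : Kac rho) (p' : Kac rho') := exists a a',
  [/\ p = \pi_(Kac rho) a, p' = \pi_(Kac rho') a'
    & mdist (phi a) (phi' a') <= e].
apply: (@dGH_le_correspondence _ _ _ C).
- by rewrite mulr_gt0.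
- by exists rho, rho'.
- move=> x; have [a' aa'] := totl (repr x).
  by exists (\pi_(Kac rho') a'), (repr x), a'; rewrite reprK.
- move=> x'; have [a aa'] := totr (repr x').
  by exists (\pi_(Kac rho) a), a, (repr x'); rewrite reprK metric_sym.
move=> _ _ _ _ [a [a' [-> -> aa]]] [b [b' [-> -> bb]]].
rewrite !mdist_Kac /dKac.
have := kac_height_le_approx e0 iphi iphi' geoE' totl rr aa bb.
(* The height estimate is one-sided; exchanging the two spaces gives the reverse bound. *)
have := kac_height_le_approx e0 iphi' iphi geoE totr.
move=> /(_ rho' rho a' b' a b); rewrite !(metric_sym (phi' _)) => /(_ rr aa bb).
have root_dist x x' : mdist (phi x) (phi' x') <= e ->
    `|mdist rho x - mdist rho' x'| <= 2 * e.
  rewrite -iphi -iphi' => xx.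
  have := metric_triangle (phi rho) (phi' rho') (phi x).
  have := metric_triangle (phi' rho') (phi' x') (phi x).
  have := metric_triangle (phi' rho') (phi rho) (phi' x').
  have := metric_triangle (phi rho) (phi x) (phi' x').
  rewrite (metric_sym (phi' x')) (metric_sym (phi' rho') (phi rho)).
  by rewrite ler_norml; lra.
move: (root_dist _ _ aa) (root_dist _ _ bb); rewrite !ler_norml; lra.
Qed.

Local Open Scope ereal_scope.

Theorem proposition2p7 (R : realType) (E E' : metricType R)
    (rho : E) (rho' : E') :
  compact [set: E] -> geodesic E ->
  compact [set: E'] -> geodesic E' ->
  dGH (Kac_root rho) (Kac_root rho') <= 6%:E * dGH rho rho'.
Proof.
move=> _ geoE _ geoE'; rewrite -lee_pdivrMl//; apply: le_ereal_inf_tmp.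
move=> r [F [phi [phi' [iphi iphi' rE]]]]; rewrite lee_pdivrMl//.
(* The value [+oo] is trivial, and [-oo] is impossible since [r] dominates a real distance. *)
case: r rE => [r rE|_|]; last 2 first.
- by rewrite gt0_muley ?leey.
- move=> /esym/eqP; rewrite eq_le => /andP[]; rewrite ge_max => /andP[_].
  by rewrite leeNy_eq.
have [Hr dr] : hausdorff_dist (range phi) (range phi') <= r%:E /\
    (mdist (phi rho) (phi' rho') <= r)%R.
  by apply/andP; rewrite -lee_fin -ge_max rE.
apply/lee_addgt0Pr => d d0.
have r0 : (0 <= r)%R by apply: le_trans dr; exact: mdist_ge0.
(* The slack [d / 6] becomes [d] after multiplication by 6, and makes the radius positive even if
   [r = 0]. *)
have re : (r < r + d / 6)%R by rewrite ltrDl divr_gt0.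
have -> : 6%:E * r%:E + d%:E = (6 * (r + d / 6))%:E.
  by rewrite -EFinM -EFinD; congr EFin; lra.
apply: (dGH_Kac_le (phi := phi) (phi' := phi')) => //.
- exact: le_lt_trans re.
- move=> x; have [|_ [x' _ <-] xx] := hausdorff_dist_le_near Hr re (x := phi x).
    by exists x.
  by exists x'.
- move=> x'; rewrite hausdorff_distC in Hr.
  have [|_ [x _ <-] xx] := hausdorff_dist_le_near Hr re (x := phi' x').
    by exists x'.
  by exists x.
- exact: le_trans dr (ltW re).
Qed.
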